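(* For every environment $\Gamma=(c,\mu)$ and every $\varepsilon>0$, there is $\Delta>0$ such that for any finite price grid of size $\Delta$, there is a finite information structure inducing a game whose set of sequential equilibrium payoff pairs is an $\varepsilon$-net of the set $\{(\pi_b,\pi_s):\pi_b\ge0,\ \pi_s\ge\underline{\pi}_s(\Gamma),\ \pi_b+\pi_s\le S(\Gamma)\}$.
   Context: Environment: $V\subset\mathbb{R}$ is compact with $\underline v=\min V<\max V=\overline v$; $\mu$ is a probability measure with support $V$; $c:V\to\mathbb{R}$ is continuous with $v-c(v)\ge0$ for all $v\in V$ and $\mathbb{E}_\mu[v-c(v)]>0$. $S(\Gamma)=\mathbb{E}[v-c(v)]$, $\underline{\pi}_s(\Gamma)=\max\{\underline v-\mathbb{E}[c(v)],0\}$. A finite information structure consists of finite signal sets $T_s,T_b$ and a probability distribution $P$ on $T_s\times T_b\times V$ with $V$-marginal $\mu$. Game: $(t_s,t_b,v)\sim P$; Seller observes $t_s$ and posts a price $p$ from the price set; Buyer observes $t_b$ and $p$ and accepts or rejects; acceptance gives Buyer $v-p$ and Seller $p-c(v)$, rejection gives both $0$. A finite price grid of size $\Delta$ is a finite set of prices whose minimum is at most $\underline v$, whose maximum is at least $\overline v$, and in which any two consecutive prices differ by at most $\Delta$. Sequential equilibrium (Kreps–Wilson) is taken in the induced finite game in which Nature directly draws $(t_b,t_s)$ from the marginal of $P$ and the payoffs from trade at price $p$ are $(\mathbb{E}[v|t_b,t_s]-p,\ p-\mathbb{E}[c(v)|t_b,t_s])$; payoffs are ex ante expected payoffs $(\pi_b,\pi_s)$.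 For $Y\subset\mathbb{R}^2$, a set $A\subset Y$ is an $\varepsilon$-net of $Y$ if every $y\in Y$ has some $a\in A$ with Euclidean distance $\|y-a\|<\varepsilon$. *)

(* Defs.v *)
From HB Require Import structures.
From mathcomp Require Import all_boot all_order all_algebra.
From mathcomp Require Import all_classical all_reals all_analysis.

Set Implicit Arguments.
Unset Strict Implicit.
Unset Printing Implicit Defensive.

Import Order.TTheory GRing.Theory Num.Theory.
Import numFieldNormedType.Exports.

Local Open Scope classical_set_scope.
Local Open Scope ring_scope.

Section Environment.
Variable R : realType.

Definition msupport (mu : set R -> \bar R) : set R :=
  [set x | forall e : R, 0 < e -> (0 < mu (ball x e))%E].

Definition environment (V : set R) (vlo vhi : R) (mu : probability R R)
    (c : R -> R) : Prop :=
  compact V /\ V vlo /\ V vhi /\ (forall v, V v -> vlo <= v <= vhi) /\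
  vlo < vhi /\
  msupport mu = V /\
  {within V, continuous c} /\
  (forall v, V v -> 0 <= v - c v) /\
  (0 < \int[mu]_(x in V) (x - c x)%:E)%E.

Definition surplus (V : set R) (mu : probability R R) (c : R -> R) : R :=
  \int[mu]_(x in V) (x - c x).

Definition seller_floor (V : set R) (vlo : R) (mu : probability R R)
    (c : R -> R) : R :=
  Num.max (vlo - \int[mu]_(x in V) c x) 0.

Definition target_set (V : set R) (vlo : R) (mu : probability R R)
    (c : R -> R) : set (R * R) :=
  [set pp | 0 <= pp.1 /\ seller_floor V vlo mu c <= pp.2 /\
            pp.1 + pp.2 <= surplus V mu c].

Definition price_grid (vlo vhi Delta : R) (s : seq R) : Prop :=
  [/\ s != [::], sorted <%R s, head 0 s <= vlo, vhi <= last 0 s &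
      forall i : nat, (i.+1 < size s)%N -> nth 0 s i.+1 - nth 0 s i <= Delta].

Definition eps_net (eps : R) (A Y : set (R * R)) : Prop :=
  A `<=` Y /\
  forall y, Y y -> exists a, A a /\
    Num.sqrt ((y.1 - a.1) ^+ 2 + (y.2 - a.2) ^+ 2) < eps.

End Environment.

Section Game.
Variable R : realType.

(** A finite information structure: finite signal sets Ts, Tb and a
    distribution P on Ts x Tb x V, given by its (finite) disintegration
    Q ts tb = P({ts} x {tb} x .), whose V-marginal is mu. *)
Definition info_structure (mu : probability R R) (Ts Tb : finType)
    (Q : Ts -> Tb -> {measure set R -> \bar R}) : Prop :=
  forall A : set R, measurable A ->
    mu A = (\sum_(ts : Ts) \sum_(tb : Tb) Q ts tb A)%E.

Variables (V : set R) (c : R -> R) (Ts Tb : finType)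
  (Q : Ts -> Tb -> {measure set R -> \bar R}) (s : seq R).

Local Notation n := (size s).

Definition price (i : 'I_n) : R := nth 0 s i.

Definition w (ts : Ts) (tb : Tb) : R := fine (Q ts tb setT).
Definition ws (ts : Ts) : R := \sum_(tb : Tb) w ts tb.
Definition wb (tb : Tb) : R := \sum_(ts : Ts) w ts tb.

Definition condEv (ts : Ts) (tb : Tb) : R :=
  (\int[Q ts tb]_(x in V) x) / w ts tb.
Definition condEc (ts : Ts) (tb : Tb) : R :=
  (\int[Q ts tb]_(x in V) c x) / w ts tb.

(** Behavioural strategies: the seller at signal ts mixes over prices;
    the buyer at information set (tb, price i) accepts with probability
    a tb i. *)
Definition seller_strategy (sig : Ts -> 'I_n -> R) : Prop :=
  forall ts, (forall i, 0 <= sig ts i) /\ \sum_(i < n) sig ts i = 1.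
Definition buyer_strategy (a : Tb -> 'I_n -> R) : Prop :=
  forall tb i, 0 <= a tb i <= 1.
Definition fully_mixed_seller (sig : Ts -> 'I_n -> R) : Prop :=
  seller_strategy sig /\ forall ts i, 0 < sig ts i.
Definition fully_mixed_buyer (a : Tb -> 'I_n -> R) : Prop :=
  forall tb i, 0 < a tb i < 1.

Definition bayes_s (ts : Ts) (tb : Tb) : R := w ts tb / ws ts.
Definition bayes_b (sig : Ts -> 'I_n -> R) (tb : Tb) (i : 'I_n) (ts : Ts) : R :=
  w ts tb * sig ts i / \sum_(ts' : Ts) w ts' tb * sig ts' i.

(** Kreps-Wilson consistency of an assessment (sig, a, mus, mub);
    information sets are those reached by Nature with positive probability. *)
Definition consistent (sig : Ts -> 'I_n -> R) (a : Tb -> 'I_n -> R)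
    (mus : Ts -> Tb -> R) (mub : Tb -> 'I_n -> Ts -> R) : Prop :=
  exists (sk : nat -> Ts -> 'I_n -> R) (ak : nat -> Tb -> 'I_n -> R),
    [/\ forall k, fully_mixed_seller (sk k) /\ fully_mixed_buyer (ak k),
        forall ts i, (fun k => sk k ts i) @ \oo --> sig ts i,
        forall tb i, (fun k => ak k tb i) @ \oo --> a tb i,
        forall ts tb, 0 < ws ts ->
          (fun k : nat => bayes_s ts tb) @ \oo --> mus ts tb &
        forall tb i ts, 0 < wb tb ->
          (fun k => bayes_b (sk k) tb i ts) @ \oo --> mub tb i ts].

Definition buyer_gain (mub : Tb -> 'I_n -> Ts -> R) (tb : Tb) (i : 'I_n) : R :=
  \sum_(ts : Ts) mub tb i ts * (condEv ts tb - price i).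

Definition seller_value (a : Tb -> 'I_n -> R) (mus : Ts -> Tb -> R)
    (ts : Ts) (tau : 'I_n -> R) : R :=
  \sum_(tb : Tb) mus ts tb *
     \sum_(i < n) tau i * a tb i * (price i - condEc ts tb).

Definition seq_rational (sig : Ts -> 'I_n -> R) (a : Tb -> 'I_n -> R)
    (mus : Ts -> Tb -> R) (mub : Tb -> 'I_n -> Ts -> R) : Prop :=
  (forall tb i, 0 < wb tb -> forall a' : R, 0 <= a' <= 1 ->
      a' * buyer_gain mub tb i <= a tb i * buyer_gain mub tb i) /\
  (forall ts, 0 < ws ts -> forall tau : 'I_n -> R,
      (forall i, 0 <= tau i) -> \sum_(i < n) tau i = 1 ->
      seller_value a mus ts tau <= seller_value a mus ts (sig ts)).

Definition payoff_b (sig : Ts -> 'I_n -> R) (a : Tb -> 'I_n -> R) : R :=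
  \sum_(ts : Ts) \sum_(tb : Tb) w ts tb *
     \sum_(i < n) sig ts i * a tb i * (condEv ts tb - price i).
Definition payoff_s (sig : Ts -> 'I_n -> R) (a : Tb -> 'I_n -> R) : R :=
  \sum_(ts : Ts) \sum_(tb : Tb) w ts tb *
     \sum_(i < n) sig ts i * a tb i * (price i - condEc ts tb).

Definition SE_payoffs : set (R * R) :=
  [set pp | exists (sig : Ts -> 'I_n -> R) (a : Tb -> 'I_n -> R)
                   (mus : Ts -> Tb -> R) (mub : Tb -> 'I_n -> Ts -> R),
     [/\ seller_strategy sig, buyer_strategy a, consistent sig a mus mub,
         seq_rational sig a mus mub & pp = (payoff_b sig a, payoff_s sig a)]].

End Game.

(* Main.v *)
Require Import Defs.
From HB Require Import structures.
From mathcomp Require Import all_boot all_order all_algebra.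
From mathcomp Require Import all_classical all_reals all_analysis.
From mathcomp Require Import measurable_realfun ring lra.
Import Order.TTheory GRing.Theory Num.Theory.
Import numFieldNormedType.Exports.
Set Implicit Arguments.
Unset Strict Implicit.
Local Open Scope classical_set_scope.
Local Open Scope ring_scope.

(** A seller of a rare "low" type, with mean value [v0] just above [vlo], makes
    it credible that an unexpected price signals a low value; the other, "high",
    type has the same information as the outside observer up to this small
    event.  The mass [eta] of the low type is tuned so that the mean value [v1]
    of the high type lies exactly on the grid.  With probability [1 - tau] the
    buyer recognises the low type, which therefore always posts the largest grid
    price [pg] below [v0]; otherwise the buyer cannot tell the two types apart.
    The high type mixes, with weights [lam] and [1 - lam], between a price [p1],
    accepted for sure, and the price [v1], at which the buyer is indifferent and
    accepts with the probability that makes the seller indifferent.  Then [p1]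
    sets the seller's payoff and [lam] the buyer's, and every point of the
    target triangle is approximated.  Conversely, every buyer accepts
    [pg >= vlo] in any equilibrium, which gives the lower bound on the seller's
    payoff. *)

(** * Measures *)

Section Measure.
Context {R : realType}.
Implicit Types (V B D : set R) (f : R -> R).

(** A point outside the support has a null ball around it, hence lies in a null interval with
    rational endpoints, and there are only countably many of these. *)
Lemma negligible_setC_msupport (mu : {measure set R -> \bar R}) :
  mu.-negligible (~` msupport mu).
Proof.
pose F (n : nat) : set R :=
  if unpickle n is Some (p, q) then
    if mu `]ratr p, ratr q[%classic == 0%E then `]ratr p, ratr q[%classic
    else set0
  else set0.
apply: (negligibleS _ (negligible_bigcup (F := F) _)).
  move=> x /= /existsNP[e /not_implyP[e0 /negP]]; rewrite -leNgt => mue.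
  have mue0 : mu (ball x e) = 0%E by apply/eqP; rewrite eq_le mue measure_ge0.
  have [p] : exists p, ratr p \in `]x - e, x[%R.
    by apply: rat_in_itvoo; rewrite ltrBlDr ltrDl.
  have [q] : exists q, ratr q \in `]x, x + e[%R.
    by apply: rat_in_itvoo; rewrite ltrDl.
  rewrite !in_itv /= => /andP[xq qe] /andP[ep px].
  have [n nE] : exists n, unpickle n = Some (p, q).
    by exists (pickle (p, q)); exact: pickleK.
  exists n; [exact: I|rewrite /F nE].
  rewrite ifT /=; first by rewrite in_itv /= px xq.
  rewrite eq_le measure_ge0 andbT -mue0; apply: le_measure.
  - by rewrite inE; exact: measurable_itv.
  - by rewrite inE ball_itv; exact: measurable_itv.
  - move=> y; rewrite ball_itv /= !in_itv /= => /andP[py yq].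
    by rewrite (lt_trans ep py) (lt_trans yq qe).
move=> n; rewrite /F; case: unpickle => [[p q]|]; last exact: negligible_set0.
case: ifPn => [/eqP mu0|_]; last exact: negligible_set0.
by exists `]ratr p, ratr q[%classic; split => //; exact: measurable_itv.
Qed.

(** The scaling rule for nonnegative integrands is applied to the positive and negative parts of
    [f], whose integrals are finite. *)
Lemma Rintegral_mscale (mu : {measure set R -> \bar R}) (k : {nonneg R}) D f :
  measurable D -> mu.-integrable D (EFin \o f) ->
  \int[mscale k mu]_(x in D) f x = k%:num * \int[mu]_(x in D) f x.
Proof.
move=> mD fi; have mf := measurable_int _ fi.
have fp := integrable_fin_num mD (integrable_funepos mD fi).
have fn := integrable_fin_num mD (integrable_funeneg mD fi).
rewrite /Rintegral integralE ge0_integral_mscale//; last first.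
  exact: measurable_realfun.measurable_funepos.
rewrite ge0_integral_mscale//; last first.
  exact: measurable_realfun.measurable_funeneg.
rewrite [in RHS]integralE -muleBr//; last first.
  by apply: fin_num_adde_defl; rewrite fin_numN.
by rewrite fineM// fin_numB fp fn.
Qed.

End Measure.

Lemma Rintegral_setID {R : realType} (mu : {measure set R -> \bar R})
    (D A : set R) (f : R -> R) :
  measurable D -> measurable A -> mu.-integrable D (EFin \o f) ->
  \int[mu]_(x in D) f x =
  \int[mu]_(x in D `&` A) f x + \int[mu]_(x in D `&` ~` A) f x.
Proof.
move=> mD mA fi.
have DE : D = (D `&` A) `|` (D `&` ~` A) by rewrite -setIUr setUv setIT.
rewrite [in LHS]DE Rintegral_setU -?DE //.
- exact: measurableI.
- by apply: measurableI => //; exact: measurableC.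
- by apply/disj_setPS; rewrite setIACA setICr setI0.
Qed.

Section TwoStep.
Context {R : realType} (mu : {finite_measure set R -> \bar R}) (B : set R)
  (mB : measurable B).

(** A density with one value on [B] and one off [B] suffices for the construction; a sum of scaled
    restrictions comes with its measure structure. *)
Definition two_step (a b : {nonneg R}) : {measure set R -> \bar R} :=
  measure_add (mscale a (mrestr mu mB)) (mscale b (mrestr mu (measurableC mB))).

Lemma two_stepE a b A :
  two_step a b A = (a%:num%:E * mu (A `&` B) + b%:num%:E * mu (A `&` ~` B))%E.
Proof. exact: measure_addE. Qed.

Lemma Rintegral_two_step (a b : {nonneg R}) (D : set R) (f : R -> R) :
  measurable D ->
  measurable_fun D f -> [bounded f x | x in D] ->
  \int[two_step a b]_(x in D) f x =
  a%:num * \int[mu]_(x in D `&` B) f x +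
  b%:num * \int[mu]_(x in D `&` ~` B) f x.
Proof.
move=> mD mf bf.
have mDB : measurable (D `&` B) by exact: measurableI.
have mDC : measurable (D `&` ~` B).
  by apply: measurableI => //; exact: measurableC.
have muy A : measurable A -> (mu A < +oo)%E.
  by move=> mA; rewrite ltey_eq fin_num_measure.
have fi : mu.-integrable D (EFin \o f).
  by apply: measurable_bounded_integrable => //; exact: muy.
have qi : (two_step a b).-integrable D (EFin \o f).
  apply: measurable_bounded_integrable => //; rewrite two_stepE.
  by apply: lte_add_pinfty; rewrite lte_mul_pinfty// muy.
rewrite (Rintegral_setID mD mB qi).
congr (_ + _); rewrite -Rintegral_mscale//.
- rewrite /Rintegral (eq_measure_integral (mscale a mu))// => A mA AD.
  rewrite two_stepE /mscale /=.
  have -> : A `&` B = A by apply/setIidl => x /AD[].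
  have -> : A `&` ~` B = set0.
    by apply/seteqP; split => // x [/AD[_ +] nBx] => /nBx.
  by rewrite measure0 mule0 adde0.
- by apply: (integrableS mD).
- rewrite /Rintegral (eq_measure_integral (mscale b mu))// => A mA AD.
  rewrite two_stepE /mscale /=.
  have -> : A `&` ~` B = A by apply/setIidl => x /AD[].
  have -> : A `&` B = set0.
    by apply/seteqP; split => // x [/AD[_ +] nBx] => /(_ nBx).
  by rewrite measure0 mule0 add0e.
- by apply: (integrableS mD).
Qed.

End TwoStep.

(** * General bounds on equilibrium payoffs *)

Lemma cvg_sumr {R : realType} (I : finType) (f : nat -> I -> R) (l : I -> R) :
  (forall i, (fun k => f k i) @ \oo --> l i) ->
  (fun k => \sum_i f k i) @ \oo --> \sum_i l i.
Proof. by move=> fl; apply: cvg_big => //; exact: add_continuous. Qed.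

Section Equilibrium.
Context {R : realType} (V : set R) (c : R -> R) (Ts Tb : finType)
  (Q : Ts -> Tb -> {measure set R -> \bar R}) (s : seq R).
Local Notation n := (size s).
Local Notation w := (w Q).
Local Notation condEv := (condEv V Q).
Local Notation condEc := (condEc V c Q).

Lemma w_ge0 ts tb : 0 <= w ts tb.
Proof. by apply: fine_ge0; exact: measure_ge0. Qed.

Lemma ws_ge0 ts : 0 <= ws Q ts.
Proof. by apply: sumr_ge0 => tb _; exact: w_ge0. Qed.

Lemma ws_eq0 ts tb : ws Q ts = 0 -> w ts tb = 0.
Proof.
move=> /eqP; rewrite psumr_eq0 => [/allP/(_ tb)|? _]; last exact: w_ge0.
by rewrite mem_index_enum => /(_ isT) /= /eqP.
Qed.

Lemma payoff_bE (sig : Ts -> 'I_n -> R) (a : Tb -> 'I_n -> R) :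
  payoff_b V Q sig a = \sum_tb \sum_i a tb i *
    \sum_ts w ts tb * sig ts i * (condEv ts tb - price i).
Proof.
rewrite /payoff_b exchange_big; apply: eq_bigr => tb _ /=.
under eq_bigr do rewrite mulr_sumr.
rewrite exchange_big; apply: eq_bigr => i _ /=.
by rewrite mulr_sumr; apply: eq_bigr => ts _; ring.
Qed.

Lemma seller_valueE (a : Tb -> 'I_n -> R) mus ts (tau : 'I_n -> R) :
  seller_value V c Q a mus ts tau = \sum_i tau i *
    \sum_tb mus ts tb * a tb i * (price i - condEc ts tb).
Proof.
rewrite /seller_value; under eq_bigr do rewrite mulr_sumr.
rewrite exchange_big; apply: eq_bigr => i _ /=.
by rewrite mulr_sumr; apply: eq_bigr => tb _; ring.
Qed.

Section Assessment.
Variables (sig : Ts -> 'I_n -> R) (a : Tb -> 'I_n -> R)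
  (mus : Ts -> Tb -> R) (mub : Tb -> 'I_n -> Ts -> R).
Hypotheses (Ssig : seller_strategy sig) (Sa : buyer_strategy a)
  (CA : consistent Q sig a mus mub) (SR : seq_rational V c Q sig a mus mub).

Lemma consistent_mus ts tb : 0 < ws Q ts -> mus ts tb = bayes_s Q ts tb.
Proof.
case: CA => sk [ak [_ _ _ H _]] /(H _ tb) cv.
exact/esym/(cvg_unique (@Rhausdorff R) (cvg_cst _) cv).
Qed.

(** At a price posted with positive probability the limit of the denominators in Bayes' rule is
    nonzero, so the rule passes to the limit. *)
Lemma consistent_mub tb i ts : 0 < wb Q tb ->
  \sum_ts' w ts' tb * sig ts' i != 0 -> mub tb i ts = bayes_b Q sig tb i ts.
Proof.
case: CA => sk [ak [_ csk _ _ H]] /(H _ i ts) cv D0.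
apply/esym/(cvg_unique (@Rhausdorff R) _ cv).
rewrite /bayes_b; apply: cvgM; first exact: cvgMr.
apply: cvgV => //; apply: cvg_sumr => ts'; exact: cvgMr.
Qed.

Lemma bayes_b_den_gt0 (tau : Ts -> 'I_n -> R) tb i :
  fully_mixed_seller tau -> 0 < wb Q tb ->
  0 < \sum_ts' w ts' tb * tau ts' i.
Proof.
move=> [_ tau0]; rewrite lt0r => /andP[wb0 _].
rewrite lt0r sumr_ge0 ?andbT => [|ts _]; last first.
  by rewrite mulr_ge0 ?w_ge0// ltW.
apply: contra wb0; rewrite psumr_eq0 => [/allP H|ts _]; last first.
  by rewrite mulr_ge0 ?w_ge0// ltW.
rewrite /wb psumr_eq0 => [|ts _]; last exact: w_ge0.
by apply/allP => ts /H /=; rewrite mulf_eq0 (gt_eqF (tau0 ts i)) orbF.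
Qed.

(** Here and in the next two lemmas, beliefs inherit the properties of a probability as limits of
    posteriors under fully mixed strategies, also at prices that are never posted. *)
Lemma consistent_mub_ge0 tb i ts : 0 < wb Q tb -> 0 <= mub tb i ts.
Proof.
case: CA => sk [ak [fm _ _ _ H]] wb0; have cv := H tb i ts wb0.
rewrite -(cvg_lim (@Rhausdorff R) cv); apply: limr_ge.
  by apply/cvg_ex; eexists; exact: cv.
near=> k; rewrite /bayes_b divr_ge0//.
  by rewrite mulr_ge0 ?w_ge0// ltW//; case: (fm k) => -[].
by rewrite ltW// bayes_b_den_gt0//; case: (fm k).
Unshelve. all: by end_near. Qed.

Lemma consistent_mub_eq0 tb i ts :
  0 < wb Q tb -> w ts tb = 0 -> mub tb i ts = 0.
Proof.
case: CA => sk [ak [_ _ _ _ H]] wb0 w0; have := H tb i ts wb0.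
rewrite /bayes_b w0; under eq_fun do rewrite mul0r mul0r.
by move=> cv; apply/esym/(cvg_unique (@Rhausdorff R) (cvg_cst _) cv).
Qed.

Lemma consistent_mub_sum tb i : 0 < wb Q tb -> \sum_ts mub tb i ts = 1.
Proof.
case: CA => sk [ak [fm _ _ _ H]] wb0.
have cv : (fun k => \sum_ts bayes_b Q (sk k) tb i ts) @ \oo
    --> \sum_ts mub tb i ts.
  by apply: cvg_sumr => ts; exact: H.
apply/esym/(cvg_unique (@Rhausdorff R) _ cv).
rewrite (_ : (fun _ => _) = fun=> 1); first exact: cvg_cst.
apply/funext => k; rewrite /bayes_b -mulr_suml divff// gt_eqF//.
by apply: bayes_b_den_gt0 => //; case: (fm k).
Qed.

(** Even off path, a consistent belief is carried by the seller signals compatible with [tb], and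
    against each of these accepting is strictly profitable. *)
Lemma buyer_accepts tb i : 0 < wb Q tb ->
  (forall ts, 0 < w ts tb -> price i < condEv ts tb) -> a tb i = 1.
Proof.
move=> wb0 pE; case: SR => /(_ tb i wb0 1); rewrite ler01 lexx => /(_ isT) H _.
suff g0 : 0 < buyer_gain V Q mub tb i.
  apply/eqP; rewrite eq_le; case/andP: (Sa tb i) => _ -> /=.
  by move: H; rewrite ler_pM2r.
have t0 ts : 0 <= mub tb i ts * (condEv ts tb - price i).
  have [w0|w0] := eqVneq (w ts tb) 0.
    by rewrite consistent_mub_eq0// mul0r.
  rewrite mulr_ge0 ?consistent_mub_ge0// subr_ge0 ltW// pE//.
  by rewrite lt0r w0 w_ge0.
rewrite lt0r sumr_ge0// andbT; apply/eqP => /eqP.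
rewrite psumr_eq0// => /allP Z.
have : \sum_ts mub tb i ts = 0.
  apply: big1 => ts _.
  have [w0|w0] := eqVneq (w ts tb) 0; first by rewrite consistent_mub_eq0.
  have /= := Z ts (mem_index_enum _).
  rewrite mulf_eq0 subr_eq0 => /orP[/eqP//|/eqP eqp].
  by have := pE ts; rewrite eqp ltxx lt0r w0 w_ge0 => /(_ isT).
by rewrite consistent_mub_sum// => /eqP; rewrite oner_eq0.
Qed.

(** Rejection yields zero, so by rationality each reached information set contributes a nonnegative
    amount; the others have weight zero. *)
Lemma payoff_b_ge0 : 0 <= payoff_b V Q sig a.
Proof.
have sig0 ts i : 0 <= sig ts i by case: (Ssig ts).
have ws0 ts tb i : 0 <= w ts tb * sig ts i by rewrite mulr_ge0// w_ge0.
rewrite payoff_bE sumr_ge0// => tb _; rewrite sumr_ge0// => i _.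
have [D0|D0] := eqVneq (\sum_ts w ts tb * sig ts i) 0.
  rewrite big1 ?mulr0// => ts _; move/eqP: D0; rewrite psumr_eq0//.
  by move=> /allP/(_ ts (mem_index_enum _)) /= /eqP ->; rewrite mul0r.
have Dgt0 : 0 < \sum_ts w ts tb * sig ts i by rewrite lt0r D0 sumr_ge0.
have wb0 : 0 < wb Q tb.
  apply: lt_le_trans Dgt0 _; apply: ler_sum => ts _.
  rewrite ler_piMr ?w_ge0//; case: (Ssig ts) => _ <-.
  by rewrite (bigD1 i)//= lerDl sumr_ge0.
have -> : \sum_ts w ts tb * sig ts i * (condEv ts tb - price i) =
    (\sum_ts w ts tb * sig ts i) * buyer_gain V Q mub tb i.
  rewrite /buyer_gain mulr_sumr; apply: eq_bigr => ts _.
  by rewrite consistent_mub// /bayes_b mulrA mulrCA divff// mulr1.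
rewrite mulrCA mulr_ge0 ?sumr_ge0//.
by case: SR => /(_ tb i wb0 0); rewrite lexx ler01 mul0r => /(_ isT).
Qed.

(** Posting [price j] after every signal is an available deviation; the interim inequalities,
    weighted by [ws], add up to the ex ante bound. *)
Lemma payoff_s_ge (j : 'I_n) :
  \sum_ts \sum_tb w ts tb * (a tb j * (price j - condEc ts tb))
  <= payoff_s V c Q sig a.
Proof.
apply: ler_sum => ts _.
have [w0|w0] := eqVneq (ws Q ts) 0.
  by rewrite !big1// => tb _; rewrite (ws_eq0 tb w0) mul0r.
have wgt0 : 0 < ws Q ts by rewrite lt0r w0 ws_ge0.
have valE tau : ws Q ts * seller_value V c Q a mus ts tau =
    \sum_tb w ts tb * \sum_i tau i * a tb i * (price i - condEc ts tb).
  rewrite mulr_sumr; apply: eq_bigr => tb _.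
  by rewrite consistent_mus// /bayes_s mulrA mulrCA divff// mulr1.
have tau0 i : (0 : R) <= (i == j)%:R by rewrite ler0n.
have tau1 : \sum_i (i == j)%:R = 1 :> R.
  by rewrite (bigD1 j)//= eqxx big1 ?addr0// => i /negbTE ->.
case: SR => _ /(_ ts wgt0 _ tau0 tau1) opt.
have := ler_wpM2l (ltW wgt0) opt; rewrite !valE.
apply: le_trans; rewrite le_eqVlt; apply/orP; left; apply/eqP.
apply: eq_bigr => tb _; congr (_ * _).
rewrite [RHS](bigD1 j)//= eqxx big1 ?addr0 ?mul1r// => i /negbTE ->.
by rewrite !mul0r.
Qed.

(** The price is a transfer and cancels; a nonnegative gain from trade remains, times a probability
    of trade at most 1. *)
Lemma payoff_total_le :
  (forall ts tb, 0 <= w ts tb * (condEv ts tb - condEc ts tb)) ->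
  payoff_b V Q sig a + payoff_s V c Q sig a <=
  \sum_ts \sum_tb w ts tb * (condEv ts tb - condEc ts tb).
Proof.
move=> gains; rewrite /payoff_b /payoff_s -big_split; apply: ler_sum => ts _ /=.
rewrite -big_split; apply: ler_sum => tb _ /=.
rewrite -mulrDr -big_split /=.
rewrite (eq_bigr (fun i => sig ts i * a tb i * (condEv ts tb - condEc ts tb)));
  last by move=> i _; ring.
rewrite -mulr_suml mulrCA ler_piMl//; case: (Ssig ts) => sig0 <-.
by apply: ler_sum => i _; rewrite ler_piMr//; case/andP: (Sa tb i).
Qed.

End Assessment.

(** Two deviations bound the seller's payoff: [jp] covers every cost and so never loses, and [jg] is
    accepted by all buyers. *)
Lemma SE_payoffs_bounds (jg jp : 'I_n) (pp : R * R) :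
  (forall tb, 0 < wb Q tb) ->
  (forall ts tb, 0 < w ts tb -> price jg < condEv ts tb) ->
  (forall ts tb, 0 < w ts tb -> condEc ts tb <= price jp) ->
  (forall ts tb, 0 <= w ts tb * (condEv ts tb - condEc ts tb)) ->
  SE_payoffs V c Q s pp ->
  [/\ 0 <= pp.1, 0 <= pp.2,
      \sum_ts \sum_tb w ts tb * (price jg - condEc ts tb) <= pp.2 &
      pp.1 + pp.2 <= \sum_ts \sum_tb w ts tb * (condEv ts tb - condEc ts tb)].
Proof.
move=> wb0 pE pc gains [sig [a [mus [mub [Ssig Sa CA SR ->]]]]] /=; split.
- exact: payoff_b_ge0 SR.
- apply: le_trans (payoff_s_ge CA SR jp).
  apply: sumr_ge0 => ts _; apply: sumr_ge0 => tb _.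
  have [->|w0] := eqVneq (w ts tb) 0; first by rewrite mul0r.
  rewrite mulr_ge0 ?w_ge0// mulr_ge0//; first by case/andP: (Sa tb jp).
  by rewrite subr_ge0 pc// lt0r w0 w_ge0.
- apply: le_trans (payoff_s_ge CA SR jg).
  apply: ler_sum => ts _; apply: ler_sum => tb _.
  by rewrite (buyer_accepts Sa CA SR)// ?mul1r// => ts'; exact: pE.
- exact: payoff_total_le.
Qed.

End Equilibrium.

(** * The two-type equilibrium *)

Lemma sum_delta {R : realType} (I : finType) (j : I) (F : I -> R) :
  \sum_i (i == j)%:R * F i = F j.
Proof.
rewrite (bigD1 j)//= eqxx mul1r big1 ?addr0// => i /negbTE ->.
by rewrite mul0r.
Qed.

Section Convergence.
Context {R : realType}.

(* The likelihood ratio x / y of the trembles is of order e, so the posterior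
   odds vanish whatever the prior weights. *)
Lemma cvg_posterior0 (wx wy : R) (e x y : nat -> R) : 0 <= wx -> 0 < wy ->
  (forall k, 0 < e k) -> (forall k, x k = e k ^+ 2) -> (forall k, e k <= y k) ->
  e @ \oo --> (0 : R) ->
  (fun k => wx * x k / (wx * x k + wy * y k)) @ \oo --> (0 : R).
Proof.
move=> wx0 wy0 e0 xE ey ce.
apply: (@squeeze_cvgr _ _ _ _ (fun=> 0) (fun k => wx / wy * e k)).
- near=> k; have ek := e0 k; have yk := lt_le_trans ek (ey k).
  have d0 : 0 < wx * x k + wy * y k.
    by rewrite ltr_wpDl ?mulr_gt0// xE mulr_ge0// ltW// exprn_gt0.
  rewrite divr_ge0 ?mulr_ge0// ?(ltW d0)//=; last by rewrite xE ltW// exprn_gt0.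
  rewrite ler_pdivrMr//.
  have -> : wx / wy * e k * (wx * x k + wy * y k) =
     wx * (e k * (wx / wy * x k) + e k * y k).
    by field; rewrite gt_eqF.
  apply: ler_wpM2l => //; rewrite xE expr2 -[leLHS]add0r lerD//.
    by rewrite !mulr_ge0 ?invr_ge0// ltW.
  by rewrite ler_wpM2l// ltW.
- exact: cvg_cst.
- by rewrite -[X in _ --> X](mulr0 (wx / wy)); apply: cvgMr.
Unshelve. all: by end_near. Qed.

End Convergence.

Section TwoTypes.
Context {R : realType} (V : set R) (c : R -> R)
  (Q : bool -> bool -> {measure set R -> \bar R}) (s : seq R).
Local Notation n := (size s).
Local Notation w := (w Q).
Local Notation condEv := (condEv V Q).
Local Notation condEc := (condEc V c Q).
(** [false] encodes the low type of the seller and the buyer who recognises it; [true] encodes the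
    high type and the buyer who cannot tell the types apart. *)
Variables (eta tau v0 v1 c0 c1 lam : R) (ig i1 i2 : 'I_n).
Hypotheses (eta01 : 0 < eta < 1) (tau01 : 0 < tau < 1) (lam01 : 0 <= lam <= 1).
Hypotheses (wFF : w false false = eta * (1 - tau))
  (wFT : w false true = eta * tau) (wTT : w true true = 1 - eta)
  (wTF : w true false = 0).
Hypotheses (EvF : forall tb, condEv false tb = v0)
  (EcF : forall tb, condEc false tb = c0)
  (EvT : condEv true true = v1) (EcT : condEc true true = c1).
(** By [tauE] the low type would be indifferent between [price ig], accepted by both buyers, and
    [v1] accepted for sure by the buyer [true] alone. *)
Hypotheses (pg_v0 : price ig < v0)
  (pg_max : forall i : 'I_n, price i < v0 -> price i <= price ig)
  (v0_p1 : v0 <= price i1) (c1_p1 : c1 <= price i1)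
  (p1_p2 : price i1 <= price i2) (p2_v1 : price i2 = v1) (c1_v1 : c1 < v1)
  (c0_pg : c0 < price ig) (tauE : tau * (v1 - c0) = price ig - c0).

(** Only the prices of the high type are meant: [ig] is posted in equilibrium too, but by the low
    type. *)
Let onpath : pred 'I_n := [pred i | (i == i1) || (i == i2)].

Let sig (ts : bool) (i : 'I_n) : R :=
  if ts then lam * (i == i1)%:R + (1 - lam) * (i == i2)%:R else (i == ig)%:R.

(** If [i1 = i2] the first test wins, in agreement with the ratio, which is then 1 by [p2_v1]. In
    the last case the good is judged to be worth [v0], and the tie at [v0] is broken by
    rejection. *)
Let acc (tb : bool) (i : 'I_n) : R :=
  if tb && (i == i1) then 1
  else if tb && (i == i2) then (price i1 - c1) / (v1 - c1)
  else (price i < v0)%R%:R.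

Let mub (tb : bool) (i : 'I_n) (ts : bool) : R :=
  if tb then (ts == onpath i)%:R else (~~ ts)%:R.

(** The shift by [n] keeps the total tremble over the [n] prices below 1. *)
Let e (k : nat) : R := (k + n).+1%:R^-1.

(* Off path a price in [onpath] is attributed to the high type and any other
   price to the low type, hence the two orders of magnitude of the trembles. *)
Let d (k : nat) (ts : bool) (i : 'I_n) : R :=
  if ts == onpath i then e k else e k ^+ 2.

Let sigk (k : nat) (ts : bool) (i : 'I_n) : R :=
  sig ts i * (1 - \sum_j d k ts j) + d k ts i.

Let acck (k : nat) (tb : bool) (i : 'I_n) : R :=
  acc tb i * (1 - e k) + e k / 2.

Let ig_offpath : onpath ig = false.
Proof.
apply/negbTE/negP => /orP[/eqP ig1|/eqP ig2].
  by move: v0_p1; rewrite -ig1 leNgt pg_v0.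
by move: (le_trans v0_p1 p1_p2); rewrite -ig2 leNgt pg_v0.
Qed.

Let e_gt0 k : 0 < e k. Proof. by rewrite invr_gt0 ltr0n. Qed.

Let e_lt1 k : e k < 1.
Proof.
rewrite invf_lt1 ?ltr0n// ltr1n ltnS addn_gt0; apply/orP; right.
exact: leq_ltn_trans (ltn_ord ig).
Qed.

Let cvg_e : e @ \oo --> (0 : R).
Proof.
have := @cvg_harmonic R; rewrite -(cvg_shiftn n) /harmonic /=; exact.
Qed.

Let d_gt0 k ts i : 0 < d k ts i.
Proof. by rewrite /d; case: ifP => _; rewrite ?exprn_gt0. Qed.

Let d_le k ts i : d k ts i <= e k.
Proof.
rewrite /d; case: ifP => _ //; rewrite expr2 ler_piMl//; first exact/ltW.
exact/ltW.
Qed.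

Let sum_d_lt1 k ts : \sum_j d k ts j < 1.
Proof.
apply: (@le_lt_trans _ _ (\sum_(j < n) e k)); first exact: ler_sum.
rewrite sumr_const card_ord -[e k *+ n]mulr_natl ltr_pdivrMr ?ltr0n//.
by rewrite mul1r ltr_nat ltnS leq_addl.
Qed.

Let cvg_d ts i : (fun k => d k ts i) @ \oo --> (0 : R).
Proof.
apply: (@squeeze_cvgr _ _ _ _ (fun=> 0) e) => //; last exact: cvg_cst.
by near=> k; rewrite d_le ltW.
Unshelve. all: by end_near. Qed.

Let sig_ge0 ts i : 0 <= sig ts i.
Proof.
case/andP: lam01 => l0 l1; rewrite /sig; case: ts; last exact: ler0n.
by rewrite addr_ge0// mulr_ge0 ?ler0n// subr_ge0.
Qed.

Let sum_sig ts (F : 'I_n -> R) : \sum_i sig ts i * F i =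
  if ts then lam * F i1 + (1 - lam) * F i2 else F ig.
Proof.
rewrite /sig; case: ts; last exact: sum_delta.
under eq_bigr do rewrite mulrDl -!mulrA.
by rewrite big_split /= -!mulr_sumr !sum_delta.
Qed.

Let strategy_sig : seller_strategy sig.
Proof.
move=> ts; split => //; under eq_bigr do rewrite -[sig ts _]mulr1.
by rewrite sum_sig; case: ts => //; ring.
Qed.

Let a2_ge0 : 0 <= (price i1 - c1) / (v1 - c1).
Proof. by rewrite divr_ge0// subr_ge0// ltW. Qed.

Let a2_le1 : (price i1 - c1) / (v1 - c1) <= 1.
Proof. by rewrite ler_pdivrMr ?subr_gt0// mul1r lerD2r -p2_v1. Qed.

Let acc01 : buyer_strategy acc.
Proof.
move=> tb i; rewrite /acc; case: ifP => _; first by rewrite ler01 lexx.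
by case: ifP => _; [rewrite a2_ge0 a2_le1 | rewrite ler0n lern1 leq_b1].
Qed.

Let fully_mixed_sigk k : fully_mixed_seller (sigk k).
Proof.
have pos ts i : 0 < sigk k ts i.
  by rewrite ltr_wpDl// mulr_ge0// subr_ge0 ltW.
split => // ts; split => [i|]; first exact/ltW.
rewrite big_split /= -mulr_suml; case: (strategy_sig ts) => _ ->.
by rewrite mul1r subrK.
Qed.

Let fully_mixed_acck k : fully_mixed_buyer (acck k).
Proof.
move=> tb i; rewrite /acck; have := e_gt0 k; have := e_lt1 k.
case/andP: (acc01 tb i) => a0 a1 e1 e0; apply/andP; split.
  by rewrite ltr_wpDl ?divr_gt0// mulr_ge0// subr_ge0 ltW.
have : acc tb i * (1 - e k) <= 1 - e k by rewrite ler_piMl// subr_ge0 ltW.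
lra.
Qed.

Let cvg_sigk ts i : (fun k => sigk k ts i) @ \oo --> sig ts i.
Proof.
rewrite -[X in _ --> X]addr0 -{1}[X in _ --> X + _]mulr1; apply: cvgD => //.
apply: cvgMr; rewrite -[X in _ --> X]subr0; apply: cvgB; first exact: cvg_cst.
rewrite [X in _ --> X](_ : 0 = \sum_(j < n) (0 : R)); last by rewrite big1.
apply: (@cvg_sumr _ _ (fun k j => d k ts j) (fun=> 0)) => j; exact: cvg_d.
Qed.

Let cvg_acck tb i : (fun k => acck k tb i) @ \oo --> acc tb i.
Proof.
rewrite -[X in _ --> X]addr0 -{1}[X in _ --> X + _]mulr1; apply: cvgD => //.
  apply: cvgMr; rewrite -[X in _ --> X]subr0; apply: cvgB => //.
  exact: cvg_cst.
by rewrite -[X in _ --> X](mul0r 2^-1); apply: cvgMl.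
Qed.

(** The type to which price [i] is not attributed never posts it in equilibrium, so in [sigk] it
    does so only through the tremble of second order, as [cvg_posterior0] requires. *)
Let off_sig ts i : ts != onpath i -> sig ts i = 0.
Proof.
rewrite /sig; case: ts => /=; last first.
  move=> Ji; case: eqP => // igE; move: Ji.
  by rewrite igE -/(onpath ig) ig_offpath.
rewrite /onpath /=; case: (i == i1) => //; case: (i == i2) => // _.
by rewrite !mulr0 addr0.
Qed.

Let sigk_good k i : e k <= sigk k (onpath i) i.
Proof.
rewrite /sigk /d eqxx -/(d _ _) lerDr mulr_ge0// subr_ge0 ltW//.
exact: sum_d_lt1.
Qed.

Let sigk_bad k i : sigk k (~~ onpath i) i = e k ^+ 2.
Proof.
rewrite /sigk off_sig; last by case: (onpath i).
by rewrite mul0r add0r /d; case: (onpath i).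
Qed.

(** The buyer [false] is certain of the low type for every [k]. For the buyer [true], one posterior
    vanishes by [cvg_posterior0] and the other is its complement. *)
Let cvg_mub tb i ts :
  (fun k => bayes_b Q (sigk k) tb i ts) @ \oo --> mub tb i ts.
Proof.
case/andP: eta01 => et0 et1; case/andP: tau01 => ta0 ta1.
have pos k := (fully_mixed_sigk k).2.
case: tb; last first.
  rewrite (_ : (fun _ => _) = fun=> (~~ ts)%:R); first exact: cvg_cst.
  apply/funext => k; rewrite /bayes_b big_bool /= wTF wFF mul0r add0r.
  case: ts; rewrite /= ?wTF ?wFF; first by rewrite !mul0r.
  by rewrite divff// !mulf_neq0 ?gt_eqF ?subr_gt0.
have wpos ts' : 0 < w ts' true.
  by case: ts'; rewrite ?wTT ?wFT ?mulr_gt0 ?subr_gt0.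
have sumE k : \sum_ts' w ts' true * sigk k ts' i =
    w (~~ onpath i) true * sigk k (~~ onpath i) i
    + w (onpath i) true * sigk k (onpath i) i.
  by rewrite big_bool /=; case: (onpath i); rewrite //= addrC.
have bad : (fun k => bayes_b Q (sigk k) true i (~~ onpath i)) @ \oo
    --> (0 : R).
  rewrite /bayes_b; under eq_fun do rewrite sumE.
  by apply: (@cvg_posterior0 _ _ _ e) => //; exact/ltW.
rewrite /mub /=; have [->|] := eqVneq ts (onpath i).
  rewrite (_ : (fun _ => _) =
      fun k => 1 - bayes_b Q (sigk k) true i (~~ onpath i)).
    by rewrite -[X in _ --> X]subr0; apply: cvgB => //; exact: cvg_cst.
  apply/funext => k; rewrite /bayes_b sumE.
  apply/esym/eqP; rewrite subr_eq -mulrDl addrC divff//.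
  by rewrite gt_eqF// addr_gt0// mulr_gt0.
by case: ts (onpath i) bad => -[].
Qed.

Let consistent_sig : consistent Q sig acc (bayes_s Q) mub.
Proof.
exists sigk, acck; split => // ts tb _; exact: cvg_cst.
Qed.

Let ws_false : ws Q false = eta.
Proof. by rewrite /ws big_bool /= wFT wFF; ring. Qed.

Let ws_true : ws Q true = 1 - eta.
Proof. by rewrite /ws big_bool /= wTT wTF addr0. Qed.

Let buyer_gainE tb i : buyer_gain V Q mub tb i =
  (if tb && onpath i then v1 else v0) - price i.
Proof.
rewrite /buyer_gain big_bool /mub /=; case: tb => /=; last first.
  by rewrite EvF; ring.
by rewrite EvF EvT; case: (onpath i) => /=; ring.
Qed.

Let buyer_rational tb i a' : 0 <= a' <= 1 ->
  a' * buyer_gain V Q mub tb i <= acc tb i * buyer_gain V Q mub tb i.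
Proof.
case/andP => a0 a1; rewrite buyer_gainE /acc /onpath /=.
have cut : a' * (v0 - price i) <= (price i < v0)%R%:R * (v0 - price i).
  case: (ltP (price i) v0) => iv /=.
    by rewrite ler_wpM2r// subr_ge0 ltW.
  by rewrite mul0r mulr_ge0_le0// subr_le0.
case: tb => //=; have [->|_] /= := eqVneq i i1.
  by rewrite ler_wpM2r// subr_ge0 -p2_v1.
have [->|_] //= := eqVneq i i2.
by rewrite p2_v1 subrr !mulr0.
Qed.

Let margin ts i :=
  \sum_tb bayes_s Q ts tb * acc tb i * (price i - condEc ts tb).

Let margin_true i : margin true i = acc true i * (price i - c1).
Proof.
rewrite /margin big_bool /= /bayes_s ws_true wTT wTF EcT divff.
  by rewrite !mul0r addr0 mul1r.
by rewrite subr_eq0 eq_sym; case/andP: eta01 => _ /lt_eqF ->.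
Qed.

Let margin_false i : margin false i =
  (tau * acc true i + (1 - tau) * acc false i) * (price i - c0).
Proof.
rewrite /margin big_bool /= /bayes_s ws_false wFT wFF !EcF.
by field; case/andP: eta01 => /gt_eqF ->.
Qed.

Let acc_i2 : acc true i2 * (v1 - c1) = price i1 - c1.
Proof.
rewrite /acc /= eqxx; case: eqP => [<-|_]; first by rewrite p2_v1 mul1r.
by rewrite divfK// subr_eq0 gt_eqF.
Qed.

Let acc_off tb i : ~~ onpath i -> acc tb i = (price i < v0)%R%:R.
Proof.
by rewrite negb_or /acc => /andP[/negbTE -> /negbTE ->]; rewrite !andbF.
Qed.

(** Both prices of the high type earn [price i1 - c1], the second because of the acceptance ratio;
    any other price sells only below [v0], hence below [price i1]. *)
Let margin_true_le i : margin true i <= price i1 - c1.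
Proof.
rewrite margin_true; have [/orP[]/eqP ->|Ji] := boolP (onpath i).
- by rewrite /acc /= eqxx mul1r.
- by rewrite p2_v1 acc_i2.
- rewrite acc_off//; case: (ltP (price i) v0) => iv /=; last first.
    by rewrite mul0r subr_ge0.
  by rewrite mul1r lerD2r; exact: le_trans (ltW iv) v0_p1.
Qed.

Let margin_true_on i : onpath i -> margin true i = price i1 - c1.
Proof.
rewrite margin_true => /orP[]/eqP ->; first by rewrite /acc /= eqxx mul1r.
by rewrite p2_v1 acc_i2.
Qed.

(** A price of the high type is refused by the buyer [false] and is at most [v1], so it earns at
    most [tau * (v1 - c0)], and [tauE] applies. Any other price sells only below [v0], where [ig] is
    the best choice. *)
Let margin_false_le i : margin false i <= price ig - c0.
Proof.
rewrite margin_false; case/andP: tau01 => t0 t1.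
have [Ji|Ji] := boolP (onpath i); last first.
  rewrite !acc_off//; case: (ltP (price i) v0) => iv /=; last first.
    by rewrite !mulr0 addr0 mul0r subr_ge0 ltW.
  rewrite !mulr1 addrC subrK mul1r lerD2r; exact: pg_max.
have [vi iv1] : v0 <= price i /\ price i <= v1.
  rewrite -p2_v1; case/orP: Ji => /eqP ->; split => //.
  exact: le_trans p1_p2.
have -> : acc false i = 0 by rewrite /acc /= ltNge vi.
rewrite mulr0 addr0 -tauE -mulrA ler_pM2l//.
apply: (@le_trans _ _ (price i - c0)); last by rewrite lerD2r.
rewrite ler_piMl//; last by case/andP: (acc01 true i).
by rewrite subr_ge0 (le_trans _ vi)// ltW// (lt_trans c0_pg).
Qed.

Let margin_false_ig : margin false ig = price ig - c0.
Proof.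
rewrite margin_false !acc_off ?ig_offpath// pg_v0 /= !mulr1.
by rewrite addrC subrK mul1r.
Qed.

Let seller_value_sig ts : seller_value V c Q acc (bayes_s Q) ts (sig ts) =
  if ts then price i1 - c1 else price ig - c0.
Proof.
rewrite seller_valueE sum_sig -!/(margin _ _); case: ts => //.
by rewrite !margin_true_on ?/onpath /= ?eqxx ?orbT//; ring.
Qed.

Let seller_rational ts (t : 'I_n -> R) :
  (forall i, 0 <= t i) -> \sum_i t i = 1 ->
  seller_value V c Q acc (bayes_s Q) ts t
  <= seller_value V c Q acc (bayes_s Q) ts (sig ts).
Proof.
move=> t0 t1; rewrite seller_value_sig seller_valueE.
rewrite -[leRHS]mul1r -t1 mulr_suml; apply: ler_sum => i _.
rewrite ler_wpM2l//; case: ts; [exact: margin_true_le|exact: margin_false_le].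
Qed.

(** At [v1] the buyer's gain is zero and the high type is indifferent, so [lam] moves the buyer's
    payoff without changing the seller's. *)
Lemma two_type_SE_payoffs : SE_payoffs V c Q s
  (eta * (v0 - price ig) + (1 - eta) * (lam * (v1 - price i1)),
   eta * (price ig - c0) + (1 - eta) * (price i1 - c1)).
Proof.
exists sig, acc, (bayes_s Q), mub; split => //.
  by split=> [tb i _|ts _]; [exact: buyer_rational|exact: seller_rational].
have a_ig tb : acc tb ig = 1 by rewrite acc_off ?ig_offpath// pg_v0.
have a_i1 : acc true i1 = 1 by rewrite /acc /= eqxx.
have sumE ts tb (F : 'I_n -> R) : \sum_i sig ts i * acc tb i * F i =
    if ts then lam * (acc tb i1 * F i1) + (1 - lam) * (acc tb i2 * F i2)
    else acc tb ig * F ig.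
  by under eq_bigr do rewrite -mulrA; rewrite sum_sig.
congr (_, _).
- rewrite /payoff_b !big_bool !sumE /= wTT wTF wFT wFF !EvF EvT.
  by rewrite !a_ig a_i1 p2_v1; ring.
- rewrite /payoff_s !big_bool !sumE /= wTT wTF wFT wFF !EcF EcT.
  by rewrite !a_ig a_i1 p2_v1 acc_i2; ring.
Qed.

End TwoTypes.

(** * Grids and approximation of the target set *)

Section Grid.
Context {R : realType}.

(** The first grid point satisfying [P] is not the head, so it has a predecessor, which fails
    [P]. *)
Lemma price_grid_jump (vlo vhi Delta : R) (s : seq R) (P : pred R) :
  price_grid vlo vhi Delta s -> ~~ P (head 0 s) -> P (last 0 s) ->
  exists i, [/\ (i.+1 < size s)%N, ~~ P (nth 0 s i), P (nth 0 s i.+1) &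
    nth 0 s i.+1 <= nth 0 s i + Delta].
Proof.
case=> s0 _ _ _ gap Ph Pl.
have hP : has P s.
  apply/hasP; exists (last 0 s) => //.
  by case: s s0 {gap Ph Pl} => //= x s _; exact: mem_last.
have : (0 < find P s)%N.
  rewrite lt0n; apply: contra Ph => /eqP f0.
  by have := nth_find 0 hP; rewrite f0 nth0.
have := nth_find 0 hP; have := hP; rewrite has_find.
case E : (find P s) => [//|i] iltn Pi _; exists i; split => //.
  by rewrite (before_find 0)// E.
by rewrite -lerBlDl; exact: gap.
Qed.

Lemma sorted_price_le (s : seq R) (i j : nat) : sorted <%R s ->
  (i < size s)%N -> (j < size s)%N -> (nth 0 s i <= nth 0 s j) = (i <= j)%N.
Proof. by move=> ss il jl; rewrite lt_sorted_leq_nth. Qed.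

Lemma sqrtr_sum_sqr_le (x y : R) : Num.sqrt (x ^+ 2 + y ^+ 2) <= `|x| + `|y|.
Proof.
rewrite -[leRHS]ger0_norm ?addr_ge0// -sqrtr_sqr ler_wsqrtr// sqrrD.
by rewrite !real_normK ?num_real// -addrA lerD2l lerDr mulrn_wge0// mulr_ge0.
Qed.

(** Gives the weight on [p1] that yields the buyer [y] when the surplus [d] left at that price
    suffices, and all of [d] otherwise. *)
Lemma convex_min (d y : R) : 0 <= d -> 0 <= y ->
  exists lam, 0 <= lam <= 1 /\ lam * d = Num.min d y.
Proof.
move=> d0 y0; exists (Num.min 1 (y / d)); split.
  by rewrite le_min ler01 divr_ge0// ge_min lexx.
have [->|dn0] := eqVneq d 0; first by rewrite mulr0 min_l.
by rewrite minr_pMl// mul1r divfK.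
Qed.

(** A finite list of bounds on [eta] is reduced to one bound on [eta * D], because with [D = m - v0]
    this product is at most the grid size. *)
Lemma small_mass (D : R) (l : seq (R * R)) : 0 < D ->
  (forall p, p \in l -> 0 < p.2) ->
  exists2 d, 0 < d & forall eta, 0 <= eta -> eta * D <= d ->
    forall p, p \in l -> eta * p.1 <= p.2.
Proof.
move=> D0; elim: l => [|[x y] l IH] l0; first by exists 1.
have [|d d0 dl] := IH; first by move=> p pl; rewrite l0// inE pl orbT.
have y0 : 0 < y by apply: (l0 (x, y)); rewrite inE eqxx.
have x0 : 0 < `|x| + 1 by rewrite ltr_wpDl.
(* The denominator dominates [x] and is positive whatever the sign of [x]. *)
exists (Num.min d (y * D / (`|x| + 1))) => [|eta e0].
  by rewrite lt_min d0 divr_gt0// mulr_gt0.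
rewrite le_min => /andP[ed ey] p; rewrite inE => /predU1P[->/=|]; last exact: dl.
move: ey; rewrite ler_pdivlMr// mulrAC ler_pM2r//; apply: le_trans.
by rewrite ler_wpM2l// (le_trans (ler_norm _))// lerDl.
Qed.

Lemma half_lt1 : (1 / 2 : R) < 1.
Proof. by rewrite mul1r invf_lt1// ltr1n. Qed.

(** [c1 - C] equals [eta * (c1 - c0)], while [C - c0] equals [(1 - eta) * (c1 - c0)] with [1 - eta]
    at least one half. *)
Lemma mean_residual_le (eta C c0 c1 : R) : 0 <= eta <= 1 / 2 ->
  C = eta * c0 + (1 - eta) * c1 -> c1 - C <= eta * (2 * `|C - c0|).
Proof.
case/andP=> e0 e1 CE.
have -> : c1 - C = eta * (c1 - c0) by rewrite CE; ring.
apply: ler_wpM2l => //.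
have [cc|cc] := leP c1 c0.
  by apply: (@le_trans _ _ 0); [rewrite subr_le0|rewrite mulr_ge0].
apply: (@le_trans _ _ (2 * (C - c0))); last by rewrite ler_pM2l// ler_norm.
have -> : 2 * (C - c0) = (2 - 2 * eta) * (c1 - c0) by rewrite CE; ring.
by rewrite ler_peMl ?subr_ge0// ?(ltW cc)//; lra.
Qed.

End Grid.

Section TwoTypeNet.
Context {R : realType} (V : set R) (c : R -> R)
  (Q : bool -> bool -> {measure set R -> \bar R}) (s : seq R).
Local Notation n := (size s).
Local Notation w := (w Q).
Local Notation condEv := (condEv V Q).
Local Notation condEc := (condEc V c Q).
Variables (eps vlo vhi Delta eta tau v0 v1 c0 c1 m C : R) (ig i2 : 'I_n).
Hypotheses (eta01 : 0 < eta < 1) (tau01 : 0 < tau < 1).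
Hypotheses (wFF : w false false = eta * (1 - tau))
  (wFT : w false true = eta * tau) (wTT : w true true = 1 - eta)
  (wTF : w true false = 0).
Hypotheses (EvF : forall tb, condEv false tb = v0)
  (EcF : forall tb, condEc false tb = c0)
  (EvT : condEv true true = v1) (EcT : condEc true true = c1).
Hypotheses (mE : m = eta * v0 + (1 - eta) * v1)
  (CE : C = eta * c0 + (1 - eta) * c1).
Hypotheses (grid : price_grid vlo vhi Delta s) (vlo_v0 : vlo < v0)
  (v0_m : v0 < m) (m_v1 : m < v1) (v1_m : v1 <= m + Delta)
  (p2_v1 : price i2 = v1) (c1_v1 : c1 < v1) (c0_v0 : c0 <= v0).
Hypotheses (pg_v0 : price ig < v0)
  (pg_max : forall i : 'I_n, price i < v0 -> price i <= price ig)
  (vlo_pg : vlo <= price ig) (c0_pg : c0 < price ig)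
  (tauE : tau * (v1 - c0) = price ig - c0).
Hypotheses (D1 : Delta <= 1) (Deps : Delta <= eps / 16)
  (v0_eps : v0 - vlo <= eps / 16) (c1_eps : c1 - C <= eps / 16)
  (eta_eps : eta * (m + 1 - vlo) <= eps / 16).

(** The deviations are [ig], below both mean values and at least [vlo], and [i2], whose price [v1]
    is above both mean costs. *)
Lemma two_type_SE_payoffs_sub (pp : R * R) : SE_payoffs V c Q s pp ->
  [/\ 0 <= pp.1, Num.max (vlo - C) 0 <= pp.2 & pp.1 + pp.2 <= m - C].
Proof.
case/andP: eta01 => e0 e1; case/andP: tau01 => t0 t1.
have pg_v1 : price ig < v1 by exact: lt_trans (lt_trans pg_v0 v0_m) m_v1.
case/(@SE_payoffs_bounds _ _ _ _ _ _ _ ig i2).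
- case; rewrite /wb big_bool /= ?wTT ?wFT ?wTF ?wFF ?add0r.
    by apply: addr_gt0; rewrite ?mulr_gt0 ?subr_gt0.
  by apply: mulr_gt0; rewrite ?subr_gt0.
- by move=> [] [] /=; rewrite ?EvF ?EvT ?wTF ?ltxx.
- move=> [] [] /=; rewrite ?EcF ?EcT ?wTF ?ltxx// p2_v1 => _; first exact: ltW.
    by rewrite (le_trans c0_v0)// ltW// (lt_trans v0_m).
  by rewrite (le_trans c0_v0)// ltW// (lt_trans v0_m).
- move=> [] [] /=; rewrite ?EvF ?EvT ?EcF ?EcT ?wTF ?mul0r// ?wTT ?wFT ?wFF;
    by rewrite mulr_ge0 ?subr_ge0// ?mulr_ge0 ?subr_ge0// ltW.
rewrite !big_bool /= !EcF !EvF EcT EvT wTT wTF wFT wFF !mul0r !addr0.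
move=> b0 s0 sg tot; split => //.
  rewrite ge_max s0 andbT; apply: le_trans sg.
  rewrite [leRHS](_ : _ = price ig - C); first by rewrite lerD2r.
  by rewrite CE; ring.
apply: le_trans tot _; rewrite le_eqVlt mE CE; apply/orP; left.
by apply/eqP; ring.
Qed.

Lemma two_type_SE_payoffs_approx (y : R * R) :
  0 <= y.1 -> Num.max (vlo - C) 0 <= y.2 -> y.1 + y.2 <= m - C ->
  exists a, SE_payoffs V c Q s a /\
    Num.sqrt ((y.1 - a.1) ^+ 2 + (y.2 - a.2) ^+ 2) < eps.
Proof.
(* [lra] only sees the hypotheses of the goal, not those of the section. *)
have [h1 h2 h3 h4] := And4 vlo_v0 v0_m m_v1 v1_m.
have [h5 h6 h7] := And3 pg_v0 vlo_pg Deps.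
have [h8 h9 h10] := And3 v0_eps c1_eps D1.
case: y => yb ys /=; rewrite ge_max => b0 /andP[s_lo s0] tot.
case/andP: eta01 => e0 e1.
case: (grid) => _ ss hd lst _.
have last_v1 : v1 <= last 0 s.
  have n0 : (0 < size s)%N by apply: leq_ltn_trans (ltn_ord i2).
  rewrite -p2_v1 /price -nth_last sorted_price_le ?ltn_predL//.
  by rewrite -ltnS prednK.
(* The seller's payoff is close to [price i1 - C], so [price i1] should be near [C + ys]. The
   equilibrium also needs it above [v0] and [c1], which exceed [C + ys] by at most [eps / 16]. *)
set X := Num.max v0 (Num.max c1 (C + ys)).
have ys_v1 : C + ys <= v1 by lra.
have X_v1 : X <= v1.
  by rewrite !ge_max (ltW c1_v1) (ltW (lt_trans v0_m m_v1)).
have [||j [jn jX Xj jgap]] := price_grid_jump (P := fun x => X <= x) grid.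
- by rewrite -ltNge lt_max (le_lt_trans hd).
- exact: le_trans last_v1.
pose i1 : 'I_n := Ordinal jn.
have [v0_p1 c1_p1 ys_p1] : [/\ v0 <= price i1, c1 <= price i1 &
    C + ys <= price i1].
  by move: Xj; rewrite !ge_max => /and3P[].
have p1_p2 : price i1 <= price i2.
  rewrite /price sorted_price_le//= ltnNge; apply: contra jX => i2j.
  apply: le_trans X_v1 _; rewrite -p2_v1 /price sorted_price_le//.
  exact: ltnW.
have jX' : nth 0 s j < X by rewrite ltNge.
have X_le : X <= C + ys + eps / 16.
  have v0_X : v0 <= C + ys + eps / 16 by lra.
  have c1_X : c1 <= C + ys + eps / 16 by lra.
  have ys_X : C + ys <= C + ys + eps / 16 by lra.
  by rewrite !ge_max v0_X c1_X.
have [lam [lam01 lamE]] : exists lam, 0 <= lam <= 1 /\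
    lam * (v1 - price i1) = Num.min (v1 - price i1) yb.
  by apply: convex_min => //; rewrite subr_ge0 -p2_v1.
have SE := two_type_SE_payoffs eta01 tau01 lam01 wFF wFT wTT wTF EvF EcF EvT
  EcT pg_v0 pg_max v0_p1 c1_p1 p1_p2 p2_v1 c1_v1 c0_pg tauE.
eexists; split; first exact: SE.
rewrite lamE /=; set x := Num.min _ _.
have p1E : price i1 = nth 0 s j.+1 by [].
rewrite -p1E in jgap ys_p1 v0_p1 c1_p1.
rewrite p2_v1 in p1_p2.
have x0 : 0 <= x by rewrite le_min b0 subr_ge0 p1_p2.
have x_y : x <= yb by rewrite ge_min lexx orbT.
have x_d : x <= v1 - price i1 by rewrite ge_min lexx.
(* Truncation costs the buyer at most the rounding error of [price i1], because [yb + ys] is at most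
   [m - C], hence below [v1 - C]. *)
have x_lo : yb - (price i1 - (C + ys)) <= x.
  have xlo1 : yb - (price i1 - (C + ys)) <= v1 - price i1 by lra.
  have xlo2 : yb - (price i1 - (C + ys)) <= yb by lra.
  by rewrite le_min xlo1.
have small z : 0 <= z -> z <= m + 1 - vlo -> 0 <= eta * z <= eps / 16.
  move=> z0 zm; rewrite mulr_ge0// ?(ltW e0)//=; apply: le_trans eta_eps.
  by rewrite ler_pM2l.
have t1 : 0 <= eta * (v0 - price ig) <= eps / 16 by apply: small; lra.
have t2 : 0 <= eta * x <= eps / 16 by apply: small => //; lra.
have t3 : 0 <= eta * (price i1 - price ig) <= eps / 16 by apply: small; lra.
apply: le_lt_trans (sqrtr_sum_sqr_le _ _) _.
have bE : yb - (eta * (v0 - price ig) + (1 - eta) * x) =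
  (yb - x) - eta * (v0 - price ig) + eta * x by ring.
have sE : ys - (eta * (price ig - c0) + (1 - eta) * (price i1 - c1)) =
  (C + ys - price i1) + eta * (price i1 - price ig) by rewrite CE; ring.
rewrite bE sE.
move: t1 t2 t3 => /andP[? ?] /andP[? ?] /andP[? ?].
(* [price i1] exceeds [C + ys] by at most [eps / 8]: one sixteenth from [X], one from the grid. Each
   term in [eta] is at most [eps / 16]. *)
apply: (@le_lt_trans _ _ (eps * (3 / 16 + 1 / 16) + eps * (3 / 16))); last lra.
by apply: lerD; rewrite ler_norml; apply/andP; split; lra.
Qed.

Lemma two_type_eps_net :
  eps_net eps (SE_payoffs V c Q s)
    [set y | 0 <= y.1 /\ Num.max (vlo - C) 0 <= y.2 /\ y.1 + y.2 <= m - C].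
Proof.
split => [pp /two_type_SE_payoffs_sub[] //|y [? [? ?]]].
exact: two_type_SE_payoffs_approx.
Qed.

End TwoTypeNet.

(** * The environment *)

Section Environment.
Context {R : realType} (V : set R) (vlo vhi : R) (mu : probability R R)
  (c : R -> R).
Hypothesis envV : environment V vlo vhi mu c.

Let cV : compact V. Proof. by case: envV. Qed.
Let Vlo : V vlo. Proof. by case: envV => _ []. Qed.
Let Vhi : V vhi. Proof. by case: envV => _ [_ []]. Qed.
Let Vitv v : V v -> vlo <= v <= vhi.
Proof. by case: envV => _ [_ [_ [+ _]]]; exact. Qed.
Let lohi : vlo < vhi. Proof. by case: envV => _ [_ [_ [_ [+ _]]]]. Qed.
Let suppV : msupport mu = V.
Proof. by case: envV => _ [_ [_ [_ [_ [+ _]]]]]. Qed.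
Let cc : {within V, continuous c}.
Proof. by case: envV => _ [_ [_ [_ [_ [_ [+ _]]]]]]. Qed.
Let gain_ge0 v : V v -> 0 <= v - c v.
Proof. by case: envV => _ [_ [_ [_ [_ [_ [_ [+ _]]]]]]]; exact. Qed.
Let gain_gt0 : (0 < \int[mu]_(x in V) (x - c x)%:E)%E.
Proof. by case: envV => _ [_ [_ [_ [_ [_ [_ [_ ]]]]]]]. Qed.

Lemma env_measurable : measurable V.
Proof. exact: compact_measurable. Qed.

Lemma env_mu : mu V = 1%E.
Proof.
have VC : mu (~` V) = 0%E.
  have [N [mN N0 VN]] := negligible_setC_msupport mu.
  apply/eqP; rewrite eq_le measure_ge0 andbT -N0 le_measure// ?inE//.
    by apply: measurableC; exact: env_measurable.
  by rewrite -suppV.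
have mV := env_measurable; have mVC := measurableC mV.
have := probability_setT mu; rewrite -(setUv V) measureU ?setICr//.
by move=> <-; rewrite [X in (_ = _ + X)%E]VC adde0.
Qed.

Lemma env_bounded_id : [bounded x | x in V].
Proof. exact: (@compact_bounded R R^o V). Qed.

Lemma env_bounded_cost : [bounded c x | x in V].
Proof.
have := @compact_bounded R R^o _ (continuous_compact cc cV).
rewrite /bounded_set /bounded_near; apply: filterS => M H x Vx.
by apply: H; exists x.
Qed.

Lemma env_measurable_cost : measurable_fun V c.
Proof. exact: (subspace_continuous_measurable_fun env_measurable cc). Qed.

Let muy A : measurable A -> (mu A < +oo)%E.
Proof. by move=> mA; rewrite ltey_eq fin_num_measure. Qed.

Lemma env_integrable (f : R -> R) : measurable_fun V f ->
  [bounded f x | x in V] -> mu.-integrable V (EFin \o f).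
Proof.
move=> mf bf; apply: measurable_bounded_integrable => //.
  exact: env_measurable.
by apply: muy; exact: env_measurable.
Qed.

Lemma env_integrable_id : mu.-integrable V (EFin \o id).
Proof. exact: (env_integrable (@measurable_id _ _ _) env_bounded_id). Qed.

Lemma env_integrable_cost : mu.-integrable V (EFin \o c).
Proof. exact: env_integrable env_measurable_cost env_bounded_cost. Qed.

Let integrable_cst k : mu.-integrable V (EFin \o cst k).
Proof. apply: env_integrable; [exact: measurable_cst|exact: bounded_cst]. Qed.

Lemma env_surplusE :
  surplus V mu c = \int[mu]_(x in V) x - \int[mu]_(x in V) c x.
Proof.
exact: (RintegralB env_measurable env_integrable_id env_integrable_cost).
Qed.

Lemma env_surplus_gt0 : 0 < surplus V mu c.
Proof.
rewrite /surplus /Rintegral fine_gt0// gain_gt0 /= ltey_eq.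
apply/orP; left; apply: integrable_fin_num; first exact: env_measurable.
exact: (integrableB env_measurable env_integrable_id env_integrable_cost).
Qed.

(** A ball around a point of the support has positive mass, all of it inside [V] up to a null set,
    and [f] is at least [k] there. *)
Lemma env_Rintegral_gt0 (f : R -> R) (x e k : R) :
  V x -> 0 < e -> 0 < k -> mu.-integrable V (EFin \o f) ->
  (forall y, V y -> 0 <= f y) -> (forall y, V y -> ball x e y -> k <= f y) ->
  0 < \int[mu]_(y in V) f y.
Proof.
move=> Vx e0 k0 fi f0 fk; have mV := env_measurable.
have mB : measurable (ball x e) by rewrite ball_itv; exact: measurable_itv.
have mVB : measurable (V `&` ball x e) by exact: measurableI.
have mub : (0 < mu (V `&` ball x e))%E.
  have := Vx; rewrite -{1}suppV => /(_ e e0); congr (_ < _)%E.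
  rewrite -[in LHS](setTI (ball x e)) -(setUv V) setIUl measureU//.
  - rewrite [X in (_ + X)%E](_ : _ = 0%E) ?adde0//.
    have [N [mN N0 VN]] := negligible_setC_msupport mu.
    apply/eqP; rewrite eq_le measure_ge0 andbT -N0 le_measure// ?inE//.
      by apply: measurableI => //; exact: measurableC.
    by rewrite -suppV => y [/VN].
  - by apply: measurableI => //; exact: measurableC.
  - by rewrite setIACA setICr set0I.
rewrite (Rintegral_setID mV mB fi) ltr_wpDr//.
  by apply: Rintegral_ge0 => y [Vy _]; exact: f0.
apply: (@lt_le_trans _ _ (k * fine (mu (V `&` ball x e)))).
  by rewrite mulr_gt0// fine_gt0// mub muy.
rewrite -Rintegral_cst//; apply: le_Rintegral => //.
- apply: measurable_bounded_integrable => //; first exact: muy.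
  exact: bounded_cst.
- by apply: (integrableS mV).
- by move=> y [Vy By]; exact: fk.
Qed.

(** Near [vhi], a point of the support, [x - vlo] is at least half the length of the value range.
    The strict inequality leaves room for [v0] below the mean. *)
Lemma env_mean_gt : vlo < \int[mu]_(x in V) x.
Proof.
have := RintegralB env_measurable env_integrable_id (integrable_cst vlo).
have muV1 : fine (mu V) = 1 by rewrite env_mu.
rewrite Rintegral_cst ?[X in _ * X]muV1 ?mulr1; last exact: env_measurable.
move=> E; rewrite -subr_gt0 -E.
apply: (@env_Rintegral_gt0 _ vhi ((vhi - vlo) / 2) ((vhi - vlo) / 2)) => //.
- by rewrite divr_gt0// subr_gt0.
- by rewrite divr_gt0// subr_gt0.
- exact: (integrableB env_measurable env_integrable_id (integrable_cst vlo)).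
- by move=> y /Vitv /andP[? _]; rewrite subr_ge0.
- by move=> y _; rewrite ball_itv /= in_itv /= => /andP[+ _]; lra.
Qed.

(** Symmetric, around [vlo]; it ensures that some grid price lies strictly above the mean. *)
Lemma env_mean_lt : \int[mu]_(x in V) x < vhi.
Proof.
have := RintegralB env_measurable (integrable_cst vhi) env_integrable_id.
have muV1 : fine (mu V) = 1 by rewrite env_mu.
rewrite Rintegral_cst ?[X in _ * X]muV1 ?mulr1; last exact: env_measurable.
move=> E; rewrite -subr_gt0 -E.
apply: (@env_Rintegral_gt0 _ vlo ((vhi - vlo) / 2) ((vhi - vlo) / 2)) => //.
- by rewrite divr_gt0// subr_gt0.
- by rewrite divr_gt0// subr_gt0.
- exact: (integrableB env_measurable (integrable_cst vhi) env_integrable_id).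
- by move=> y /Vitv /andP[_ ?]; rewrite subr_ge0.
- by move=> y _; rewrite ball_itv /= in_itv /= => /andP[_]; lra.
Qed.

End Environment.

Lemma probability_setC_fine {R : realType} (mu : probability R R) (B : set R) :
  measurable B -> fine (mu (~` B)) = 1 - fine (mu B).
Proof.
by move=> mB; rewrite probability_setC// fineB// fin_num_measure.
Qed.

(** * The value distribution of the low type *)

Section LowDensity.
Context {R : realType} (V : set R) (vlo vhi : R) (mu : probability R R)
  (c : R -> R).
Hypothesis envV : environment V vlo vhi mu c.

(** The prior conditioned on values up to [vlo + r / 2] is mixed with a little of the prior itself.
    The admixture makes [vlo < v0] and [c0 < v0] strict even if the conditioned law sits at [vlo] or
    has no gains from trade. *)
Lemma low_density (r : R) : 0 < r -> exists (B : set R) (a b v0 c0 : R),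
  [/\ measurable B, 0 <= a, 0 <= b &
      a * fine (mu B) + b * fine (mu (~` B)) = 1] /\
  [/\ v0 = a * \int[mu]_(x in V `&` B) x + b * \int[mu]_(x in V `&` ~` B) x,
      c0 = a * \int[mu]_(x in V `&` B) c x + b * \int[mu]_(x in V `&` ~` B) c x,
      vlo < v0, v0 <= vlo + r & c0 < v0].
Proof.
move=> r0; case: (envV) => [_ [Vlo [_ [Vitv [_ [suppV [_ [gain0 _]]]]]]]].
have mV := env_measurable envV; have muV := env_mu envV.
have idi := env_integrable_id envV; have ci := env_integrable_cost envV.
have mgt := env_mean_gt envV; have Sgt := env_surplus_gt0 envV.
have SE := env_surplusE envV.
set mean := \int[mu]_(x in V) x in mgt SE.
set cost := \int[mu]_(x in V) c x in SE.
pose B := V `&` `]-oo, vlo + r / 2]%classic.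
have mB : measurable B by apply: measurableI => //; exact: measurable_itv.
have VB : V `&` B = B by rewrite setIA setIid.
have B0 : 0 < fine (mu B).
  rewrite fine_gt0//; apply/andP; split; last first.
    by rewrite ltey_eq fin_num_measure.
  have r2 : 0 < r / 2 by rewrite divr_gt0.
  have := Vlo; rewrite -suppV => /(_ _ r2) /lt_le_trans; apply.
  have muVC : mu (~` V) = 0%E by rewrite probability_setC// muV subee.
  rewrite [leRHS](_ : _ = mu (B `|` ~` V)); last first.
    by apply/esym/measureU0 => //; exact: measurableC.
  apply: le_measure; rewrite ?inE.
  - by rewrite ball_itv; exact: measurable_itv.
  - by apply: measurableU => //; exact: measurableC.
  - move=> x; rewrite ball_itv /= in_itv /= => /andP[_ xr].
    have [Vx|nVx] := pselect (V x); [left|by right].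
    by split => //=; rewrite in_itv /= ltW.
set beta := fine (mu B) in B0 *.
have kB k : \int[mu]_(x in B) k = k * beta by rewrite Rintegral_cst.
have ki k : mu.-integrable B (EFin \o (fun=> k)).
  apply: measurable_bounded_integrable => //; last exact: bounded_cst.
  by rewrite ltey_eq fin_num_measure.
have idB : mu.-integrable B (EFin \o id).
  by apply: (integrableS mV) => // x [].
have cB : mu.-integrable B (EFin \o c).
  by apply: (integrableS mV) => // x [].
have lo : vlo * beta <= \int[mu]_(x in B) x.
  by rewrite -kB; apply: le_Rintegral => // x [/Vitv /andP[]].
have hi : \int[mu]_(x in B) x <= (vlo + r / 2) * beta.
  by rewrite -kB; apply: le_Rintegral => // x [_]; rewrite /= in_itv.
have gB : \int[mu]_(x in B) c x <= \int[mu]_(x in B) x.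
  by apply: le_Rintegral => // x [/gain0]; rewrite subr_ge0.
have := Rintegral_setID mV mB idi; rewrite VB -/mean /= => meanE.
have := Rintegral_setID mV mB ci; rewrite VB -/cost /= => costE.
(* The weight of the prior: it raises the mean by at most [r / 2], and the summand [r] in the
   denominator keeps it below 1. *)
pose theta := (r / 2) / (mean - vlo + r).
have d0 : 0 < mean - vlo + r by lra.
have th0 : 0 < theta by rewrite !divr_gt0.
have th1 : theta < 1 by rewrite ltr_pdivrMr// mul1r; lra.
have thE : theta * (mean - vlo) <= r / 2.
  rewrite /theta mulrAC ler_pdivrMr// ler_pM2l ?divr_gt0//; lra.
have split_mean (x y z : R) : z = x + y ->
    ((1 - theta) / beta + theta) * x + theta * y =
    (1 - theta) * (x / beta) + theta * z.
  by move=> ->; ring.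
have lo' : vlo <= (\int[mu]_(x in B) x) / beta by rewrite ler_pdivlMr.
have hi' : (\int[mu]_(x in B) x) / beta <= vlo + r / 2 by rewrite ler_pdivrMr.
have gB' : (\int[mu]_(x in B) c x) / beta <= (\int[mu]_(x in B) x) / beta.
  by rewrite ler_pM2r ?invr_gt0.
set p := _ / beta in lo' hi' gB' *; set q := _ / beta in gB' *.
have th1' : theta <= 1 by exact: ltW.
exists B, ((1 - theta) / beta + theta), theta.
do 2!eexists; split; [split => //|split; [reflexivity|reflexivity| | |]].
- by rewrite addr_ge0 ?divr_ge0// ?subr_ge0 ltW.
- exact: ltW.
- by rewrite probability_setC_fine// -/beta; field; rewrite gt_eqF.
- rewrite VB (split_mean _ _ _ meanE) -subr_gt0.
  have -> : (1 - theta) * p + theta * mean - vlo =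
    (1 - theta) * (p - vlo) + theta * (mean - vlo) by ring.
  by rewrite ltr_wpDl ?mulr_ge0 ?subr_ge0// mulr_gt0// subr_gt0.
- rewrite VB (split_mean _ _ _ meanE).
  have : (1 - theta) * (p - vlo) <= p - vlo.
    by rewrite ler_piMl ?subr_ge0//; lra.
  have -> : (1 - theta) * p + theta * mean =
    vlo + (1 - theta) * (p - vlo) + theta * (mean - vlo) by ring.
  lra.
- rewrite VB (split_mean _ _ _ meanE) (split_mean _ _ _ costE) -subr_gt0.
  have -> : (1 - theta) * p + theta * mean - ((1 - theta) * q + theta * cost) =
    (1 - theta) * (p - q) + theta * surplus V mu c by rewrite SE; ring.
  by rewrite ltr_wpDl ?mulr_ge0 ?subr_ge0// mulr_gt0.
Qed.

End LowDensity.

(** * The information structure *)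

Section TwoStepStructure.
Context {R : realType} (V : set R) (mu : probability R R) (B : set R)
  (mB : measurable B) (eta tau a b : R).

(** [k] is the low type's density at a value: the low type takes [eta * k] of the prior there, split
    between the buyers by [tau], and the high type takes the rest. The four shares add up to 1 for
    every [k]. *)
Definition share (k : R) (ts tb : bool) : R :=
  if ts then (if tb then 1 - eta * k else 0)
  else eta * (if tb then tau else 1 - tau) * k.

(* The absolute values only serve to build nonnegative weights: the shares are
   nonnegative by [share_ge0]. *)
Definition two_type_structure (ts tb : bool) : {measure set R -> \bar R} :=
  two_step mu mB (`|share a ts tb|%:nng) (`|share b ts tb|%:nng).

Hypotheses (eta01 : 0 < eta < 1) (tau01 : 0 < tau < 1) (a0 : 0 <= a)
  (b0 : 0 <= b) (eta_a : eta * a <= 1) (eta_b : eta * b <= 1).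

Lemma share_ge0 k ts tb : 0 <= k -> eta * k <= 1 -> 0 <= share k ts tb.
Proof.
case/andP: eta01 => e0 _; case/andP: tau01 => t0 t1 k0 ek.
rewrite /share; case: ts; case: tb => //; first by rewrite subr_ge0.
  by rewrite !mulr_ge0// ltW.
by rewrite !mulr_ge0// ?subr_ge0 ltW.
Qed.

Lemma two_type_structureE ts tb A : two_type_structure ts tb A =
  ((share a ts tb)%:E * mu (A `&` B) + (share b ts tb)%:E * mu (A `&` ~` B))%E.
Proof.
by rewrite /two_type_structure two_stepE /= !ger0_norm// share_ge0.
Qed.

Lemma two_type_info_structure : info_structure mu two_type_structure.
Proof.
move=> A mA; rewrite !big_bool !two_type_structureE /share.
have mAB : measurable (A `&` B) by exact: measurableI.
have mAC : measurable (A `&` ~` B).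
  by apply: measurableI => //; exact: measurableC.
have AE : (A `&` B) `|` (A `&` ~` B) = A by rewrite -setIUr setUv setIT.
have muA : (mu A = mu (A `&` B) + mu (A `&` ~` B))%E.
  by rewrite -{1}AE; apply: measureU => //; rewrite setIACA setICr setI0.
rewrite muA -(fineK (fin_num_measure mu _ mAB)).
rewrite -(fineK (fin_num_measure mu _ mAC)).
by rewrite -!EFinM -!EFinD; congr (_%:E); ring.
Qed.

Lemma two_type_w ts tb : w two_type_structure ts tb =
  share a ts tb * fine (mu B) + share b ts tb * fine (mu (~` B)).
Proof.
have mC : measurable (~` B) by exact: measurableC.
rewrite /w two_type_structureE !setTI fineD ?fineM ?fin_num_measure//.
- by rewrite fin_numM// fin_num_measure.
- by rewrite fin_numM// fin_num_measure.
Qed.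

Lemma two_type_Rintegral (f : R -> R) ts tb : measurable V ->
  measurable_fun V f -> [bounded f x | x in V] ->
  \int[two_type_structure ts tb]_(x in V) f x =
  share a ts tb * \int[mu]_(x in V `&` B) f x +
  share b ts tb * \int[mu]_(x in V `&` ~` B) f x.
Proof.
move=> mV mf bf; rewrite /two_type_structure Rintegral_two_step//=.
by rewrite !ger0_norm ?share_ge0.
Qed.

Hypothesis mass1 : a * fine (mu B) + b * fine (mu (~` B)) = 1.

Lemma two_type_wE ts tb : w two_type_structure ts tb =
  if ts then (if tb then 1 - eta else 0)
  else eta * (if tb then tau else 1 - tau).
Proof.
rewrite two_type_w /share; case: ts; last first.
  by rewrite -[RHS]mulr1 -mass1; ring.
case: tb; last by rewrite !mul0r addr0.
rewrite -[eta in RHS]mulr1 -mass1 probability_setC_fine//.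
by ring.
Qed.

(** The buyer's signal is independent of the value given the low type, hence one mean for both [tb];
    the high type's mean is what the law of total expectation leaves. *)
Lemma two_type_mean (f : R -> R) (low high : R) : measurable V ->
  measurable_fun V f -> [bounded f x | x in V] ->
  mu.-integrable V (EFin \o f) ->
  \int[mu]_(x in V) f x = eta * low + (1 - eta) * high ->
  low = a * \int[mu]_(x in V `&` B) f x + b * \int[mu]_(x in V `&` ~` B) f x ->
  (forall tb, (\int[two_type_structure false tb]_(x in V) f x) /
     w two_type_structure false tb = low) /\
  (\int[two_type_structure true true]_(x in V) f x) /
     w two_type_structure true true = high.
Proof.
move=> mV mf bf fi; rewrite (Rintegral_setID mV mB fi) => totE lowE.
split=> [tb|];
  rewrite two_type_wE two_type_Rintegral// /share.
  have wn0 : eta * (if tb then tau else 1 - tau) != 0.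
    case/andP: eta01 => ? _; case/andP: tau01 => ? ?.
    by case: tb; rewrite mulf_neq0 ?gt_eqF ?subr_gt0.
  by rewrite -!mulrA -!mulrDr -lowE mulrA mulrAC divff// mul1r.
have e1 : 1 - eta != 0 by case/andP: eta01 => _ ?; rewrite gt_eqF// subr_gt0.
apply: (mulIf e1); rewrite divfK// mulrC -[RHS](addKr (eta * low)).
by rewrite [high * _]mulrC -totE lowE; ring.
Qed.

End TwoStepStructure.

Theorem mainTheorem2 (R : realType) (V : set R) (vlo vhi : R)
    (mu : probability R R) (c : R -> R) :
  environment V vlo vhi mu c ->
  forall eps : R, 0 < eps ->
  exists Delta : R, 0 < Delta /\
    forall s : seq R, price_grid vlo vhi Delta s ->
    exists (Ts Tb : finType) (Q : Ts -> Tb -> {measure set R -> \bar R}),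
      info_structure mu Q /\
      eps_net eps (SE_payoffs V c Q s) (target_set V vlo mu c).
Proof.
move=> envV eps eps0.
have mV := env_measurable envV.
have idm : measurable_fun V (@idfun R) by exact: measurable_id.
have cm := env_measurable_cost envV.
have idb := env_bounded_id envV; have cb := env_bounded_cost envV.
have idi := env_integrable_id envV; have ci := env_integrable_cost envV.
have SE := env_surplusE envV; have S0 := env_surplus_gt0 envV.
have m_lo := env_mean_gt envV; have m_hi := env_mean_lt envV.
rewrite /target_set /seller_floor SE; rewrite SE in S0; clear SE.
have [m mE] : exists m, \int[mu]_(x in V) x = m by eexists.
have [C CE] : exists C, \int[mu]_(x in V) c x = C by eexists.
rewrite CE mE in S0 *; rewrite mE in m_lo m_hi.
(* The first bound puts [v0] close to [vlo], the second puts it below the mean [m]. *)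
pose r := Num.min (eps / 16) ((m - vlo) / 2).
have r0 : 0 < r by rewrite lt_min !divr_gt0// subr_gt0.
have r1 : r <= eps / 16 by rewrite ge_min lexx.
have r2 : r <= (m - vlo) / 2 by rewrite ge_min lexx orbT.
have [B [a [b [v0 [c0 [[mB a0 b0 ab1] [v0E c0E lo_v0 v0_r c0_v0]]]]]]] :=
  low_density envV r0.
clearbody r.
have v0m : v0 < m by lra.
(* In order: [eta] at most one half, nonnegative shares for [a] and for [b], positive gains for the
   high type, small payoff errors, and [c1] close to [C]. *)
have [d d0 small] := @small_mass _ (m - v0) [:: (1, 1 / 2); (a, 1); (b, 1);
  (v0 - c0, (m - C) / 2); (m + 1 - vlo, eps / 16);
  (2 * `|C - c0|, eps / 16)] ltac:(by rewrite subr_gt0) ltac:(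
  by move=> p; rewrite !inE => /or3P[|| /or4P[]] /eqP -> //=; rewrite divr_gt0).
(* Besides the rounding errors, [v0 - vlo] serves to get [vlo <= pg], the half gain to get
   [c0 < pg], and [d] to make [eta] small. *)
pose Delta := Num.min (Num.min 1 (eps / 16))
  (Num.min (Num.min (v0 - vlo) ((v0 - c0) / 2)) d).
have gain2 : 0 < (v0 - c0) / 2 by rewrite divr_gt0// subr_gt0.
have D0 : 0 < Delta.
  by rewrite !lt_min ltr01 gain2 d0 subr_gt0 lo_v0 divr_gt0.
have D1 : Delta <= 1 by rewrite !ge_min lexx.
have D2 : Delta <= eps / 16 by rewrite !ge_min lexx !orbT.
have D3 : Delta <= v0 - vlo by rewrite !ge_min lexx !orbT.
have D4 : Delta < v0 - c0.
  apply: (@le_lt_trans _ _ ((v0 - c0) / 2)).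
    by rewrite !ge_min lexx !orbT.
  by rewrite ltr_pdivrMr// ltr_pMr ?ltr1n// subr_gt0.
have D5 : Delta <= d by rewrite !ge_min lexx !orbT.
exists Delta; split => // s grid; clearbody Delta.
case: (grid) => _ ss hd lst _.
(* [pg] is the last grid price below [v0], and [v1] the first one above [m]. *)
have [||jg [jgn pg_v0 v0_next gap_g]] :=
  price_grid_jump (P := fun x => v0 <= x) grid.
- by rewrite -ltNge (le_lt_trans hd).
- exact: le_trans (ltW (lt_trans v0m m_hi)) lst.
have [||j2 [j2n p_m m_p2 gap_2]] := price_grid_jump (P := fun x => m < x) grid.
- by rewrite -leNgt (le_trans hd)// ltW.
- exact: lt_le_trans lst.
rewrite -ltNge in pg_v0; rewrite -leNgt in p_m.
pose ig : 'I_(size s) := Ordinal (ltnW jgn).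
pose i2 : 'I_(size s) := Ordinal j2n.
set v1 := nth 0 s j2.+1 in m_p2 gap_2.
set pg := nth 0 s jg in pg_v0 gap_g.
have v1_m : v1 <= m + Delta by apply: le_trans gap_2 _; rewrite lerD2r.
(* The solution of [m = eta * v0 + (1 - eta) * v1]. *)
pose eta := (v1 - m) / (v1 - v0).
have v10 : 0 < v1 - v0 by rewrite subr_gt0 (lt_trans v0m).
have eta0 : 0 < eta by rewrite divr_gt0// subr_gt0.
have etaE : eta * (v1 - v0) = v1 - m by rewrite divfK// gt_eqF.
have eta_d : eta * (m - v0) <= d.
  apply: le_trans D5; apply: (@le_trans _ _ (eta * (v1 - v0))).
    by rewrite ler_pM2l// lerD2r ltW.
  by rewrite etaE lerBlDl.
have {}small := small eta (ltW eta0) eta_d.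
have eta_half : eta <= 1 / 2.
  by rewrite -[eta]mulr1; apply: (small (1, 1 / 2)); rewrite !inE eqxx.
have eta1 := le_lt_trans eta_half half_lt1.
have eta01 : 0 < eta < 1 by rewrite eta0.
pose tau := (pg - c0) / (v1 - c0).
have v0_pg : v0 - Delta <= pg by rewrite lerBlDr (le_trans v0_next).
have c0_pg : c0 < pg.
  by apply: lt_le_trans v0_pg; rewrite ltrBrDl -ltrBrDr.
have vlo_pg : vlo <= pg.
  by apply: le_trans v0_pg; rewrite lerBrDl -lerBrDr.
have pg_v1 : pg < v1 by rewrite (lt_trans pg_v0)// (lt_trans v0m).
have v1c0 : 0 < v1 - c0 by rewrite subr_gt0 (lt_trans c0_pg).
have tauE : tau * (v1 - c0) = pg - c0 by rewrite divfK// gt_eqF.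
have tau01 : 0 < tau < 1.
  apply/andP; split; first by rewrite divr_gt0// subr_gt0.
  by rewrite ltr_pdivrMr// mul1r ltrD2r.
have ea : eta * a <= 1 by apply: (small (a, 1)); rewrite !inE eqxx !orbT.
have eb : eta * b <= 1 by apply: (small (b, 1)); rewrite !inE eqxx !orbT.
have ev : eta * (v0 - c0) <= (m - C) / 2.
  by apply: (small (v0 - c0, (m - C) / 2)); rewrite !inE eqxx !orbT.
have em : eta * (m + 1 - vlo) <= eps / 16.
  by apply: (small (m + 1 - vlo, eps / 16)); rewrite !inE eqxx !orbT.
have ec : eta * (2 * `|C - c0|) <= eps / 16.
  by apply: (small (2 * `|C - c0|, eps / 16)); rewrite !inE eqxx !orbT.
clearbody eta tau.
have n_eta : 1 - eta != 0 by rewrite gt_eqF// subr_gt0.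
have [c1 c1E] : exists c1, C = eta * c0 + (1 - eta) * c1.
  exists ((C - eta * c0) / (1 - eta)).
  by rewrite [(1 - eta) * _]mulrC divfK//; ring.
have v1E : m = eta * v0 + (1 - eta) * v1.
  by rewrite -[LHS](subKr v1) -etaE; ring.
pose Q := two_type_structure mu mB eta tau a b.
have wE := two_type_wE mB eta01 tau01 a0 b0 ea eb ab1.
rewrite -/Q in wE.
have [EvF EvT] := two_type_mean mB eta01 tau01 a0 b0 ea eb ab1 mV idm idb idi
  (etrans mE v1E) v0E.
have [EcF EcT] := two_type_mean mB eta01 tau01 a0 b0 ea eb ab1 mV cm cb ci
  (etrans CE c1E) c0E.
have c1v1 : c1 < v1.
  (* The high type's gains are the total surplus minus those of the low type, which by [ev] take at
     most half of it. *)
  have : 0 < (1 - eta) * (v1 - c1).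
    rewrite (_ : _ * _ = (m - C) - eta * (v0 - c0)).
      rewrite subr_gt0 (le_lt_trans ev)// ltr_pdivrMr// ltr_pMr ?ltr1n//.
    by rewrite {1}v1E {1}c1E; ring.
  by rewrite pmulr_rgt0 ?subr_gt0.
have c1C : c1 - C <= eps / 16.
  by apply: le_trans ec; apply: mean_residual_le c1E; rewrite ltW.
have v0eps : v0 - vlo <= eps / 16 by rewrite lerBlDl (le_trans v0_r)// lerD2l.
have pg_max (i : 'I_(size s)) : price i < v0 -> price i <= price ig.
  move=> iv; rewrite /price sorted_price_le// -ltnS ltnNge.
  apply/negP => gi.
  have : price i < nth 0 s jg.+1 by exact: lt_le_trans v0_next.
  by rewrite ltNge /price sorted_price_le// gi.
exists bool, bool, Q; split; first exact: two_type_info_structure.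
exact: (@two_type_eps_net R V c Q s eps vlo vhi Delta eta tau v0 v1 c0 c1
  m C ig i2
  eta01 tau01 (wE false false) (wE false true) (wE true true)
  (wE true false) EvF EcF EvT EcT v1E c1E grid lo_v0 v0m m_p2 v1_m erefl c1v1
  (ltW c0_v0) pg_v0 pg_max vlo_pg c0_pg tauE D1 D2 v0eps c1C em).
Qed.
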